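(* Let $(G,S)$ be a right-angled Artin group and let $w\in G$. Then for all $x,y\in G$, $$x\bullet_wy=\lim_{n\to\infty}Y\big(x,y,w^n\varphi_w(x)\big),$$ i.e. there is $m\ge0$ (depending on $x,y$) such that $x\bullet_wy=Y(x,y,w^n\varphi_w(x))$ for all $n\ge m$.
   Context: $(G,S)$ is a right-angled Artin group: $S\subseteq G$ is a (possibly infinite) generating set of the group $G$ with $S\cap S^{-1}=\emptyset$, and $G$ has the presentation $\langle S\,;\,[s,t]=1$ for those $s\neq t$ in $S$ with $st=ts$ in $G\rangle$. Let $l$ be the word length on $G$ with respect to $S\cup S^{-1}$. Write $x\subset y$ iff $l(x)+l(x^{-1}y)=l(y)$; this is a partial order with least element $1$, in which any two elements have a greatest lower bound $x\cap y$. Put $[x,y]=\{z\in G: x^{-1}z\subset x^{-1}y\}$ and $Y(x,y,z)=x(x^{-1}y\cap x^{-1}z)$, the unique element of $[x,y]\cap[y,z]\cap[z,x]$. A subset $I$ is convex if $[x,y]\subseteq I$ for all $x,y\in I$. For $w\in G$ put $\varphi_w(x)=Y(wx,x,w^{-1}x)$. Let $\preceq_w$ be the preorder $x\preceq_wy\iff y\in[x,wy]$. For $x,y\in G$ the set $U_{x,y}=\{z\in[x,y]:x\preceq_wz,\ y\preceq_wz\}$ is nonempty and convex, and $x\bullet_wy$ denotes its element nearest to $x$, i.e. the unique $c\in U_{x,y}$ with $c\in[x,z]$ for all $z\in U_{x,y}$ (this is the quasidirection determined by $\preceq_w$). *)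

(* Defs.v *)
From mathcomp Require Import all_boot.
From mathcomp Require Import boolp classical_sets.

Set Implicit Arguments.
Unset Strict Implicit.
Unset Printing Implicit Defensive.

Local Open Scope classical_set_scope.
Local Open Scope group_scope.

(* A word over A is a sequence of letters (a, b), read as a if b = false and   *)
(* as the formal inverse of a if b = true.                                     *)
Definition word (A : Type) := seq (A * bool).

Definition letter_inv (A : Type) (a : A * bool) : A * bool := (a.1, ~~ a.2).

(* Equality in the group < A ; r = 1 for r in R >.                             *)
Inductive pres_eq (A : Type) (R : set (word A)) : word A -> word A -> Prop :=
| pres_refl u : pres_eq R u u
| pres_sym u v : pres_eq R u v -> pres_eq R v u
| pres_trans u v t : pres_eq R u v -> pres_eq R v t -> pres_eq R u t
| pres_cancel u v a : pres_eq R (u ++ [:: a; letter_inv a] ++ v) (u ++ v)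
| pres_relator u v r : R r -> pres_eq R (u ++ r ++ v) (u ++ v).

Section RAAG.
Variables (G : groupType) (S : set G).

Definition letter_val (a : S * bool) : G :=
  if a.2 then (\val a.1)^-1 else \val a.1.

Definition word_val (u : word S) : G := \prod_(a <- u) letter_val a.

Definition generates : Prop := forall g : G, exists u : word S, word_val u = g.

(* S generates G, and the induced map < S ; R > -> G is well defined and       *)
(* injective.                                                                  *)
Definition has_presentation (R : set (word S)) : Prop :=
  generates /\ forall u v : word S, word_val u = word_val v <-> pres_eq R u v.

Definition raag_relators : set (word S) :=
  [set r | exists s t : S,
     [/\ s <> t, commute (\val s) (\val t) &
         r = [:: (s, true); (t, true); (s, false); (t, false)]]].

Definition is_raag : Prop :=
  S `&` [set s | S s^-1] = set0 /\ has_presentation raag_relators.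

(* The default values 0 and 1 used below are never reached when is_raag holds: *)
(* the elements selected by xget then exist and are unique.                    *)
Definition word_length (g : G) : nat :=
  xget 0 [set n | (exists2 u : word S, word_val u = g & size u = n) /\
                  (forall u : word S, word_val u = g -> n <= size u)].

Definition prefix_le (x y : G) : Prop :=
  (word_length x + word_length (x^-1 * y))%N = word_length y.

Definition meet (x y : G) : G :=
  xget 1 [set z | [/\ prefix_le z x, prefix_le z y &
                   forall t, prefix_le t x -> prefix_le t y -> prefix_le t z]].

Definition interval (x y : G) : set G :=
  [set z | prefix_le (x^-1 * z) (x^-1 * y)].

Definition median (x y z : G) : G := x * meet (x^-1 * y) (x^-1 * z).

Definition axis_proj (w x : G) : G := median (w * x) x (w^-1 * x).

Definition quasidir_le (w x y : G) : Prop := interval x (w * y) y.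

Definition quasidir_set (w x y : G) : set G :=
  [set z | [/\ interval x y z, quasidir_le w x z & quasidir_le w y z]].

Definition quasidir_op (w x y : G) : G :=
  xget 1 [set c | quasidir_set w x y c /\
                  forall z, quasidir_set w x y z -> interval x z c].

End RAAG.

(* Main.v *)
(* The cosets g C_t, where C_t is generated by the letters s <> t commuting *)
(* with t, are the walls of the Cayley graph: the parity of the number of *)
(* t-edges starting in g C_t along a path depends only on its end points (check *)
(* a cancellation and a commutation square), so each wall cuts G into two *)
(* sides.  A word crossing a wall twice contains a d a^-1 with d in C_t, hence *)
(* can be shortened; so z lies in [x, y] iff no wall separates z from x and y, *)
(* and medians, meets and quasidirections are computed wall by wall. *)
(*   Two walls whose labels are equal or do not commute never cross; in *)
(* particular a wall never crosses its translates.  Writing *)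
(* x^-1 w x = k v k^-1 with all words k v^n k^-1 reduced (n > 0), one gets *)
(* phi_w x = x k and w^n phi_w x = x k v^n, a geodesic ray, which stays on one *)
(* side of each of the finitely many walls separating x from y once n is large. *)
(* The defining properties of the quasidirection are then checked for the limit *)
(* on one wall M at a time, by comparing M with its translate w^-1 M. *)
Require Import Defs.
From mathcomp Require Import all_boot.
From mathcomp Require Import boolp classical_sets.

Set Implicit Arguments.
Unset Strict Implicit.
Unset Printing Implicit Defensive.

Local Open Scope group_scope.

(** The Cayley graph is handled as a median graph whose hyperplanes are the cosets of [C_t], here
    [linkgen t]. Sides of walls ([hs]) are well defined by [parity_pres]. Deletion
    ([reduced_convex]) and [exchange] translate lengths into sides: intervals are intersections of
    half-spaces ([interval_hsP]), an element is determined by its sides ([hs_inj]), and a median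
    lies on the majority side of every wall ([hs_median]). The claim can thus be tested on one wall
    at a time.

    By [axis_ray] the points [w^n phi_w(x)] lie on a geodesic ray or are constant, so each wall is
    crossed at most once; only finitely many walls separate [x] from [y], so the median stabilises.
    That its final value is the quasidirection ([quasidir_op_ray]) rests on [no_crossing]: a wall
    [M] and its translate [w^-1 M] have the same label, so one of their four quadrants is empty. If
    a defining property failed at [M], then either all four quadrants would be occupied, or the
    points [w^k x] would be confined to a side of [M] that the ray eventually avoids, although each
    point of the ray is a median of such points. *)

Section RightAngledArtin.
Variables (G : groupType) (S : set G).
Implicit Types (x y z g : G) (s t : S) (a b : S * bool) (u v : word S).
Implicit Types (M N : S * G).

(** * Words *)

Definition word_inv u : word S := rev (map (@letter_inv S) u).

Lemma word_val_nil : word_val ([::] : word S) = 1.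
Proof. exact: big_nil. Qed.

Lemma word_val_cons a u : word_val (a :: u) = letter_val a * word_val u.
Proof. exact: big_cons. Qed.

Lemma word_val_cat u v : word_val (u ++ v) = word_val u * word_val v.
Proof. exact: big_cat. Qed.

Lemma word_val_rcons u a : word_val (rcons u a) = word_val u * letter_val a.
Proof. by rewrite -cats1 word_val_cat word_val_cons word_val_nil mulg1. Qed.

Lemma letter_val_inv a : letter_val (letter_inv a) = (letter_val a)^-1.
Proof. by case: a => s [] //=; rewrite /letter_val /= invgK. Qed.

Lemma letter_invK : involutive (@letter_inv S).
Proof. by case=> s []. Qed.

Lemma word_inv_cons a u : word_inv (a :: u) = rcons (word_inv u) (letter_inv a).
Proof. by rewrite /word_inv /= rev_cons. Qed.

Lemma word_inv_cat u v : word_inv (u ++ v) = word_inv v ++ word_inv u.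
Proof. by rewrite /word_inv map_cat rev_cat. Qed.

Lemma word_invK : involutive word_inv.
Proof. by move=> u; rewrite /word_inv map_rev revK mapK //; apply: letter_invK. Qed.

Lemma word_val_inv u : word_val (word_inv u) = (word_val u)^-1.
Proof.
elim: u => [|a u IHu]; first by rewrite word_val_nil invg1.
by rewrite word_inv_cons word_val_rcons word_val_cons IHu letter_val_inv invgM.
Qed.

Definition link t s : bool := (s != t) && `[< commute (\val s) (\val t) >].

Definition in_link t a : bool := link t a.1.

Definition linkgen t : set G :=
  [set g | exists2 u, word_val u = g & all (in_link t) u]%classic.

Lemma link_sym s t : link s t = link t s.
Proof.
by rewrite /link eq_sym; congr (_ && _); apply/asboolP/asboolP => /commute_sym.
Qed.

Lemma link_irr t : link t t = false.
Proof. by rewrite /link eqxx. Qed.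

Lemma all_link_inv t u : all (in_link t) (word_inv u) = all (in_link t) u.
Proof. by rewrite all_rev all_map. Qed.

Lemma linkgen1 t : linkgen t 1.
Proof. by exists [::]; rewrite ?word_val_nil. Qed.

Lemma linkgen_word t u : all (in_link t) u -> linkgen t (word_val u).
Proof. by exists u. Qed.

Lemma linkgenM t x y : linkgen t x -> linkgen t y -> linkgen t (x * y).
Proof.
move=> [u <- Lu] [v <- Lv]; exists (u ++ v); first by rewrite word_val_cat.
by rewrite all_cat Lu.
Qed.

Lemma linkgenV t x : linkgen t x -> linkgen t x^-1.
Proof.
move=> [u <- Lu]; exists (word_inv u); first by rewrite word_val_inv.
by rewrite all_link_inv.
Qed.

Lemma linkgen_letter t a : link t a.1 -> linkgen t (letter_val a).
Proof.
by move=> La; exists [:: a]; rewrite /= ?/in_link ?La //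
  word_val_cons word_val_nil mulg1.
Qed.

Lemma linkgenMl t x y : linkgen t x -> linkgen t (x * y) <-> linkgen t y.
Proof.
move=> Lx; split=> [|]; last exact: linkgenM.
by move/(linkgenM (linkgenV Lx)); rewrite mulKg.
Qed.

Lemma linkgenMr t x y : linkgen t y -> linkgen t (x * y) <-> linkgen t x.
Proof.
move=> Ly; split=> [|/linkgenM]; last exact.
by move/linkgenM/(_ (linkgenV Ly)); rewrite mulgK.
Qed.

Lemma linkgen_commute a g : linkgen a.1 g -> commute (letter_val a) g.
Proof.
case=> u <-; elim: u => [|b u IHu] /=.
  by rewrite word_val_nil => _; apply: commute1.
case/andP=> /andP[_ /asboolP cab] /IHu cau; rewrite word_val_cons.
apply: commuteM => //; rewrite /letter_val.
have cab' := commute_sym cab.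
by case: a.2; case: b.2 => //;
  do ?[apply: commuteV | apply/commute_sym; apply: commuteV].
Qed.

Lemma linkgen_conj a g :
  linkgen a.1 (letter_val a * g * (letter_val a)^-1) -> linkgen a.1 g.
Proof.
move=> Lg; suff -> : g = letter_val a * g * (letter_val a)^-1 by [].
apply: (mulgI (letter_val a)); rewrite (linkgen_commute Lg).
by rewrite mulgVK.
Qed.

(** * Walls *)

(** The end of the edge from which its generator is read positively; it is the same for both
    directions of travel, and its coset of [C_t] names the wall crossed. *)
Definition edge_base x a : G := if a.2 then x * (\val a.1)^-1 else x.

Definition crosses t x a : bool :=
  (a.1 == t) && `[< linkgen t (edge_base x a) >].

Fixpoint parity t x u : bool :=
  if u is a :: u' then crosses t x a (+) parity t (x * letter_val a) u'
  else false.

Lemma edge_baseM g x a : edge_base (g * x) a = g * edge_base x a.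
Proof. by rewrite /edge_base; case: ifP; rewrite ?mulgA. Qed.

Lemma edge_base_inv x a :
  edge_base (x * letter_val a) (letter_inv a) = edge_base x a.
Proof. by case: a => s []; rewrite /edge_base /letter_val //= mulgK. Qed.

Lemma crosses_inv t x a :
  crosses t (x * letter_val a) (letter_inv a) = crosses t x a.
Proof. by rewrite /crosses edge_base_inv. Qed.

Lemma crossesMl t g x a : linkgen t g -> crosses t (g * x) a = crosses t x a.
Proof.
move=> Lg; rewrite /crosses edge_baseM; congr (_ && _).
exact/asbool_equiv_eq/linkgenMl.
Qed.

Lemma crosses_false t x a : a.1 != t -> crosses t x a = false.
Proof. by rewrite /crosses => /negPf->. Qed.

Lemma parity_cat t x u v :
  parity t x (u ++ v) = parity t x u (+) parity t (x * word_val u) v.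
Proof.
elim: u x => [|a u IHu] x /=; first by rewrite word_val_nil mulg1.
by rewrite IHu word_val_cons addbA mulgA.
Qed.

Lemma parityMl t g x u : linkgen t g -> parity t (g * x) u = parity t x u.
Proof.
by move=> Lg; elim: u x => //= a u IHu x; rewrite crossesMl // -mulgA IHu.
Qed.

Lemma parity_link t x u : all (fun a => a.1 != t) u -> parity t x u = false.
Proof. by elim: u x => //= a u IHu x /andP[at_ /IHu->]; rewrite crosses_false. Qed.

Lemma crosses_link t x a b :
  link a.1 b.1 -> crosses t (x * letter_val b) a = crosses t x a.
Proof.
move=> Lb; rewrite /crosses; case: eqP => //= <-.
have cab := linkgen_commute (linkgen_letter Lb).
have -> : edge_base (x * letter_val b) a = edge_base x a * letter_val b.
  rewrite /edge_base; case a2: a.2 => //; move: cab; rewrite {1}/letter_val a2 => cab.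
  by rewrite -!mulgA; congr (_ * _); apply: commute_sym.
exact/asbool_equiv_eq/linkgenMr/linkgen_letter.
Qed.

Hypothesis raagS : is_raag S.

Lemma ex_word g : exists u : word S, word_val u = g.
Proof. by case: raagS => _ []. Qed.

Lemma pres_eqP u v : word_val u = word_val v <-> pres_eq (@raag_relators G S) u v.
Proof. by case: raagS => _ []. Qed.

(** A cancelled pair runs along one edge twice, and opposite edges of a commutation square cross the
    same walls ([crosses_link]); both change the count by an even number. *)
Lemma parity_pres t x u v :
  pres_eq (@raag_relators G S) u v -> parity t x u = parity t x v.
Proof.
move=> Puv.
elim: {u v} Puv x => [//|u v _ IH x|u v r _ IHu _ IHv x|u v a x|u v r Rr x].
- by rewrite IH.
- by rewrite IHu.
- rewrite !parity_cat /= crosses_inv addbF addbb addFb.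
  by rewrite !word_val_cons word_val_nil letter_val_inv mulg1 mulgV mulg1.
have r1 : word_val r = 1.
  have /pres_eqP := @pres_relator _ (@raag_relators G S) [::] [::] r Rr.
  by rewrite cats0 word_val_nil.
rewrite !parity_cat r1 mulg1; congr (_ (+) _); rewrite -[RHS]addFb; congr (_ (+) _).
case: Rr => s1 [s2 [/eqP s12 c12 ->]] /=.
have L21 : link s2 s1 by rewrite /link s12; apply/asboolP.
have L12 : link s1 s2 by rewrite link_sym.
(* Reading the two inverse letters backwards leaves two pairs of opposite positive edges. *)
set x1 := x * _; rewrite -(crosses_inv t x1 (s1, true)).
set y := x1 * _; rewrite -(crosses_inv t y (s2, true)).
rewrite (@crosses_link t y (s1, false)) //.
rewrite (@crosses_link t _ (s2, false) (s1, false)) //.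
rewrite /letter_inv /=.
by do 2!case: (crosses _ _ _).
Qed.

Lemma parity_val t x u v :
  word_val u = word_val v -> parity t x u = parity t x v.
Proof. by move/pres_eqP/parity_pres. Qed.

(** * Half-spaces *)

Definition side t g : bool := `[< exists2 u, word_val u = g & parity t 1 u >].

Lemma side_word t u : side t (word_val u) = parity t 1 u.
Proof.
by apply/asboolP/idP => [[v /(parity_val t 1)->]|Pu] //; exists u.
Qed.

Lemma sideM t g a : side t (g * letter_val a) = side t g (+) crosses t g a.
Proof.
have [u <-] := ex_word g.
by rewrite -word_val_rcons !side_word -cats1 parity_cat /= mul1g addbF.
Qed.

Lemma side_linkgen t g : linkgen t g -> side t g = false.
Proof.
case=> u <- Lu; rewrite side_word parity_link //.
by apply: sub_all Lu => a /andP[]; rewrite eq_sym.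
Qed.

Lemma sideMl t d g : linkgen t d -> side t (d * g) = side t g.
Proof.
move=> Ld; have [u <-] := ex_word g; have [v vd] := ex_word d.
rewrite -vd -word_val_cat !side_word parity_cat mul1g vd -[d]mulg1 parityMl //.
by rewrite -[parity t 1 v]side_word vd side_linkgen.
Qed.

(* The pair [(t, g)] stands for the wall [g C_t]. *)
Definition hs M x : bool := side M.1 (M.2^-1 * x).

Definition edge_wall x a : S * G := (a.1, edge_base x a).

Definition translate g M : S * G := (M.1, g * M.2).

Lemma hs_translate g M x : hs (translate g M) x = hs M (g^-1 * x).
Proof. by rewrite /hs /= invgM mulgA. Qed.

Lemma hs_edge M x a :
  hs M (x * letter_val a) = hs M x (+) crosses M.1 (M.2^-1 * x) a.
Proof. by rewrite /hs mulgA sideM. Qed.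

Lemma hs_neq M x a :
  (hs M (x * letter_val a) == ~~ hs M x) = crosses M.1 (M.2^-1 * x) a.
Proof. by rewrite hs_edge; case: crosses; case: hs. Qed.

Lemma hs_linkgen M g : linkgen M.1 (M.2^-1 * g) -> hs M =1 hs (M.1, g).
Proof.
by move=> Lg x; rewrite /hs /= -[RHS](sideMl _ Lg) -mulgA mulVKg.
Qed.

Lemma crossing_label M x a : hs M (x * letter_val a) = ~~ hs M x -> a.1 = M.1.
Proof. by move/eqP; rewrite hs_neq => /andP[/eqP]. Qed.

Lemma crossing_wall M x a :
  hs M (x * letter_val a) = ~~ hs M x -> hs M =1 hs (edge_wall x a).
Proof.
move/eqP; rewrite hs_neq => /andP[/eqP at_ /asboolP Lx].
by rewrite /edge_wall at_; apply: hs_linkgen; rewrite -edge_baseM.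
Qed.

Lemma hs_edge_wall x a : hs (edge_wall x a) x = a.2.
Proof.
rewrite /hs /= /edge_base; case a2: a.2; last first.
  by rewrite mulVg side_linkgen //; apply: linkgen1.
rewrite invgM invgK -mulgA mulVg mulg1.
have -> : \val a.1 = 1 * letter_val (a.1, false) by rewrite mul1g.
rewrite sideM side_linkgen; last exact: linkgen1.
by rewrite /crosses eqxx /=; apply/asboolP/linkgen1.
Qed.

Lemma hs_edge_wallN x a : hs (edge_wall x a) (x * letter_val a) = ~~ a.2.
Proof.
apply/eqP; rewrite -(hs_edge_wall x a) hs_neq /crosses eqxx /=; apply/asboolP.
by rewrite edge_baseM /edge_base /=; case: ifP => _; rewrite ?mulVg; apply: linkgen1.
Qed.

Lemma crossing_pair M x y a b :
  hs M (x * letter_val a) = ~~ hs M x -> hs M (y * letter_val b) = ~~ hs M y ->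
  linkgen a.1 ((edge_base x a)^-1 * edge_base y b).
Proof.
move=> /eqP Mx /eqP My; move: Mx My; rewrite !hs_neq.
move=> /andP[/eqP-> /asboolP Lx] /andP[_ /asboolP Ly].
move: (linkgenM (linkgenV Lx) Ly); rewrite !edge_baseM.
by rewrite invgM -mulgA mulKg.
Qed.

(** * Paths crossing walls *)

Lemma first_change (T : eqType) (f : G -> T) x u :
  f (x * word_val u) != f x ->
  exists u1 a u2, [/\ u = u1 ++ a :: u2, f (x * word_val u1) = f x &
                      f (x * word_val u1 * letter_val a) != f x].
Proof.
elim: u x => [|a u IHu] x; first by rewrite word_val_nil mulg1 eqxx.
rewrite word_val_cons mulgA => fu.
case: (eqVneq (f (x * letter_val a)) (f x)) => [fa|fa]; last first.
  by exists [::], a, u; rewrite word_val_nil mulg1.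
rewrite -fa in fu; have [u1 [b [u2 [-> f1 fb]]]] := IHu _ fu.
exists (a :: u1), b, u2; rewrite word_val_cons mulgA -fa; split => //.
Qed.

Lemma neqbP (c d : bool) : reflect (c = ~~ d) (c != d).
Proof. by case: c; case: d; constructor. Qed.

Lemma first_crossing M x u :
  hs M (x * word_val u) = ~~ hs M x ->
  exists u1 a u2, [/\ u = u1 ++ a :: u2, hs M (x * word_val u1) = hs M x &
                      hs M (x * word_val u1 * letter_val a) = ~~ hs M x].
Proof.
move/neqbP/first_change => [u1 [a [u2 [uE e1 /neqbP e2]]]].
by exists u1, a, u2.
Qed.

Lemma hsM_linkgen M t d x :
  ~~ link t M.1 -> linkgen t d -> hs M (x * d) = hs M x.
Proof.
move=> nMt [u <- Lu]; apply/eqP/negPn/negP => /neqbP.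
case/first_crossing => u1 [a [u2 [uE <- /crossing_label aM]]].
by move: Lu; rewrite uE all_cat /= /in_link aM (negPf nMt) andbF.
Qed.

Lemma hs_edge_base M x a :
  hs M (x * letter_val a) = hs M x -> hs M (edge_base x a) = hs M x.
Proof. by rewrite /edge_base /letter_val; case: a.2. Qed.

(* The edges crossing [N] are joined by paths all of whose letters commute *)
(* with, and differ from, the label of [N]; such paths do not cross [M]. *)
Lemma hs_carrier M N x y a b :
  ~~ link N.1 M.1 ->
  hs N (x * letter_val a) = ~~ hs N x -> hs N (y * letter_val b) = ~~ hs N y ->
  hs M (x * letter_val a) = hs M x -> hs M (y * letter_val b) = hs M y ->
  hs M x = hs M y.
Proof.
move=> nNM Nx Ny Mx My; have Lxy := crossing_pair Nx Ny.
rewrite -(hs_edge_base Mx) -(hs_edge_base My).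
rewrite -[edge_base y b](mulVKg (edge_base x a)).
by rewrite (hsM_linkgen _ _ Lxy) // (crossing_label Nx).
Qed.

Lemma ex_path x y : exists u : word S, x * word_val u = y.
Proof. by have [u uE] := ex_word (x^-1 * y); exists u; rewrite uE mulVKg. Qed.

Lemma ex_crossing M x y :
  hs M y = ~~ hs M x -> exists z a, hs M (z * letter_val a) = ~~ hs M z.
Proof.
have [u <-] := ex_path x y.
move/first_crossing=> [u1 [a [u2 [_ e1 e2]]]].
by exists (x * word_val u1), a; rewrite e2 e1.
Qed.

(** By [hs_carrier], all edges crossing [N] lie on one side of [M], and vice versa, so the quadrant
    avoiding both families of edges could never be left. Equal labels are covered, hence a wall and
    its translates. *)
Lemma no_crossing M N (b c : bool) p q r o :
  ~~ link M.1 N.1 -> hs M p = b -> hs N p = c -> hs M q = b -> hs N q = ~~ c ->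
  hs M r = ~~ b -> hs N r = c -> hs M o = ~~ b -> hs N o = ~~ c -> False.
Proof.
move=> nMN Mp Np Mq Nq Mr Nr Mo No.
have nNM : ~~ link N.1 M.1 by rewrite link_sym.
have MN z a : hs M (z * letter_val a) = ~~ hs M z ->
    hs N (z * letter_val a) = ~~ hs N z -> False.
  move=> /crossing_wall Mw /crossing_wall Nw.
  have E g : hs M g = hs N g by rewrite Mw Nw.
  by move: Mq; rewrite -Mp !E Np Nq; case: (c).
have Mstay z a : hs N (z * letter_val a) = ~~ hs N z ->
    hs M (z * letter_val a) = hs M z.
  by move=> Nz; apply/eqP/negPn/negP => /neqbP /MN; apply.
have Nstay z a : hs M (z * letter_val a) = ~~ hs M z ->
    hs N (z * letter_val a) = hs N z.
  by move=> Mz; apply/eqP/negPn/negP => /neqbP; apply: MN.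
have [y [a Ny]] : exists z a, hs N (z * letter_val a) = ~~ hs N z.
  by apply: (@ex_crossing _ p q); rewrite Np.
have [x [a' Mx]] : exists z a, hs M (z * letter_val a) = ~~ hs M z.
  by apply: (@ex_crossing _ p r); rewrite Mp.
(* [k] lies in the quadrant opposite to the edges of [N] (as seen by [M]) and *)
(* to those of [M] (as seen by [N]): a path from [k] to [y] cannot leave it. *)
have [k Mk Nk] : exists2 k, hs M k = ~~ hs M y & hs N k = ~~ hs N x.
  have [yb|/neqbP->] := eqVneq (hs M y) b; have [xc|/neqbP->] := eqVneq (hs N x) c.
  - by exists o; rewrite ?yb ?xc.
  - by exists r; rewrite ?yb ?negbK.
  - by exists q; rewrite ?xc ?negbK.
  - by exists p; rewrite ?negbK.
have [u uE] := ex_path k y.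
have /(first_change (f := fun g => (hs M g, hs N g)))[u1 [d [u2 [_ [e1 e2] e3]]]] :
    (hs M (k * word_val u), hs N (k * word_val u)) != (hs M k, hs N k).
  by rewrite uE Mk xpair_eqE; case: (hs M y).
move: e3; rewrite xpair_eqE negb_and -e1 -e2 => /orP[|] /neqbP Hd.
  have := hs_carrier nMN Mx Hd (Nstay _ _ Mx) (Nstay _ _ Hd).
  by rewrite e2 Nk; case: (hs N x).
have := hs_carrier nNM Ny Hd (Mstay _ _ Ny) (Mstay _ _ Hd).
by rewrite e1 Mk; case: (hs M y).
Qed.

Lemma backtrack M x a u b :
  hs M (x * letter_val a) = ~~ hs M x ->
  hs M (x * letter_val a * word_val u) = hs M (x * letter_val a) ->
  hs M (x * letter_val a * word_val u * letter_val b) = hs M x ->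
  b = letter_inv a /\ linkgen a.1 (word_val u).
Proof.
move=> Ma Mu Mb; set y := x * _ * _ in Mu Mb.
have Mb' : hs M (y * letter_val b) = ~~ hs M y by rewrite Mb Mu Ma negbK.
have ba : b.1 = a.1 by rewrite (crossing_label Mb') (crossing_label Ma).
have b2 : b.2 = ~~ a.2.
  rewrite -(hs_edge_wall y b) -(hs_edge_wall x a).
  by rewrite -(crossing_wall Mb') -(crossing_wall Ma) Mu Ma.
split; first by rewrite /letter_inv -ba -b2; case: (b).
have := crossing_pair Ma Mb'; rewrite /edge_base b2 ba /y.
have := @linkgen_conj a (word_val u); rewrite /letter_val.
case: a.2 => /= Lu; rewrite ?mulKg //.
by rewrite -!mulgA mulKg mulgA.
Qed.

Lemma parallel M x a u b :
  hs M (x * letter_val a) = ~~ hs M x -> hs M (x * word_val u) = hs M x ->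
  hs M (x * word_val u * letter_val b) = ~~ hs M x ->
  b = a /\ linkgen a.1 (word_val u).
Proof.
move=> Ma Mu Mb; set y := x * _ in Mu Mb.
have Mb' : hs M (y * letter_val b) = ~~ hs M y by rewrite Mb Mu.
have ba : b.1 = a.1 by rewrite (crossing_label Mb') (crossing_label Ma).
have b2 : b.2 = a.2.
  rewrite -(hs_edge_wall y b) -(hs_edge_wall x a).
  by rewrite -(crossing_wall Mb') -(crossing_wall Ma).
split; first by rewrite [b]surjective_pairing [a]surjective_pairing ba b2.
have := crossing_pair Ma Mb'; rewrite /edge_base b2 ba /y.
have := @linkgen_conj (letter_inv a) (word_val u).
rewrite letter_val_inv invgK /letter_val /=.
case: a.2 => /= Lu; last by rewrite mulKg.
by rewrite invgM invgK -!mulgA mulKg mulgA; move: Lu; rewrite invgK.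
Qed.

(** * Reduced words and intervals *)

Local Notation wl := (@word_length G S).

Lemma word_length_spec g :
  (exists2 u : word S, word_val u = g & size u = wl g) /\
  (forall u : word S, word_val u = g -> wl g <= size u)%N.
Proof.
rewrite /word_length; set P := [set n | _]%classic.
apply: (@xgetPex _ 0%N P).
have [u0 u0g] := ex_word g.
have ex : exists n, `[< exists2 u : word S, word_val u = g & size u = n >].
  by exists (size u0); apply/asboolP; exists u0.
case: (ex_minnP ex) => m /asboolP[u ug um] min.
by exists m; split; [exists u | move=> v vg; apply: min; apply/asboolP; exists v].
Qed.

Lemma ex_shortest g : exists2 u : word S, word_val u = g & size u = wl g.
Proof. by case: (word_length_spec g). Qed.

Lemma word_length_le u : (wl (word_val u) <= size u)%N.
Proof. by case: (word_length_spec (word_val u)) => _; apply. Qed.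

Lemma word_length1 : wl 1 = 0%N.
Proof. by apply/eqP; rewrite -leqn0 -word_val_nil (word_length_le [::]). Qed.

Lemma word_length_eq0 g : wl g = 0%N -> g = 1.
Proof. by case: (ex_shortest g) => u <- <- /size0nil ->; apply: word_val_nil. Qed.

Lemma word_lengthM x y : (wl (x * y) <= wl x + wl y)%N.
Proof.
have [u <- <-] := ex_shortest x; have [v <- <-] := ex_shortest y.
by rewrite -word_val_cat -size_cat; apply: word_length_le.
Qed.

Lemma word_length_letter a : (wl (letter_val a) <= 1)%N.
Proof.
rewrite -[letter_val a]mulg1 -word_val_nil -word_val_cons.
exact: (word_length_le [:: a]).
Qed.

Definition reduced u : bool := (size u <= wl (word_val u))%N.

Lemma reduced_size u : reduced u -> size u = wl (word_val u).
Proof. by move=> Ru; apply/eqP; rewrite eqn_leq word_length_le andbT. Qed.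

Lemma ex_reduced g : exists2 u, word_val u = g & reduced u.
Proof. by have [u ug us] := ex_shortest g; exists u; rewrite // /reduced ug us. Qed.

Lemma reduced_catl u v : reduced (u ++ v) -> reduced u.
Proof.
rewrite /reduced size_cat word_val_cat => R.
rewrite -(leq_add2r (size v)) (leq_trans R) // (leq_trans (word_lengthM _ _)) //.
by rewrite leq_add2l word_length_le.
Qed.

Lemma reduced_catr u v : reduced (u ++ v) -> reduced v.
Proof.
rewrite /reduced size_cat word_val_cat => R.
rewrite -(leq_add2l (size u)) (leq_trans R) // (leq_trans (word_lengthM _ _)) //.
by rewrite leq_add2r word_length_le.
Qed.

Lemma reduced_backtrack u1 a u2 u3 :
  linkgen a.1 (word_val u2) -> ~~ reduced (u1 ++ a :: u2 ++ letter_inv a :: u3).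
Proof.
move=> /linkgen_commute c; rewrite /reduced -ltnNge.
have -> : word_val (u1 ++ a :: u2 ++ letter_inv a :: u3) =
    word_val (u1 ++ u2 ++ u3).
  rewrite !word_val_cat word_val_cons word_val_cat word_val_cons letter_val_inv.
  by congr (_ * _); rewrite !mulgA c mulgK.
rewrite (leq_ltn_trans (word_length_le _)) // !size_cat /= size_cat /=.
by rewrite ltn_add2l ltnS addnS leqnSn.
Qed.

(** A word that leaves a half-space and comes back contains [a d a^-1] with [d] commuting with [a]
    ([backtrack]), and deleting the two letters shortens it. *)
Lemma reduced_convex M x u v :
  reduced (u ++ v) -> hs M (x * word_val (u ++ v)) = hs M x ->
  hs M (x * word_val u) = hs M x.
Proof.
move=> R Muv; apply/eqP/negPn/negP => /neqbP.
case/first_crossing => u1 [a [u2 [uE M1 Ma]]].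
have Mback : hs M (x * word_val u1 * letter_val a * word_val (u2 ++ v)) =
    ~~ hs M (x * word_val u1 * letter_val a).
  have <- : x * word_val (u ++ v) =
      x * word_val u1 * letter_val a * word_val (u2 ++ v).
    by rewrite uE -catA /= [word_val (u1 ++ _)]word_val_cat word_val_cons !mulgA.
  by rewrite Ma Muv negbK.
have [v1 [b [v2 [vE e1 e2]]]] := first_crossing Mback.
have Ma' : hs M (x * word_val u1 * letter_val a) = ~~ hs M (x * word_val u1).
  by rewrite Ma M1.
rewrite Ma' negbK in e2.
have [bE /reduced_backtrack/negP] := backtrack Ma' e1 e2; apply.
move: R; rewrite uE -catA /= vE bE; exact.
Qed.

(** A shortest word from [x] to [y] has to cross the wall of [a]; by [parallel] the crossing letter
    is [a] itself and can be moved to the front. *)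
Lemma exchange x y a :
  hs (edge_wall x a) y = ~~ a.2 ->
  (wl ((x * letter_val a)^-1 * y)).+1 = wl (x^-1 * y).
Proof.
move=> My; set M := edge_wall x a in My.
have Ma : hs M (x * letter_val a) = ~~ hs M x by rewrite hs_edge_wallN hs_edge_wall.
have [u uxy us] := ex_shortest (x^-1 * y).
have Mu : hs M (x * word_val u) = ~~ hs M x by rewrite uxy mulVKg My hs_edge_wall.
have [u1 [b [u2 [uE e1 e2]]]] := first_crossing Mu.
have [ba /linkgen_commute c] := parallel Ma e1 e2.
apply/eqP; rewrite eqn_leq; apply/andP; split.
  have -> : (x * letter_val a)^-1 * y = word_val (u1 ++ u2).
    rewrite invgM -mulgA -uxy uE ba !word_val_cat word_val_cons.
    by rewrite [X in _ * X]mulgA -c -mulgA mulKg.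
  rewrite -us (leq_ltn_trans (word_length_le _)) // uE !size_cat /=.
  by rewrite addnS.
have -> : x^-1 * y = letter_val a * ((x * letter_val a)^-1 * y).
  by rewrite invgM -mulgA mulVKg.
by rewrite -add1n (leq_trans (word_lengthM _ _)) // leq_add2r word_length_letter.
Qed.

Lemma reduced_cons_hs x a u :
  reduced (a :: u) -> hs (edge_wall x a) (x * word_val (a :: u)) = ~~ a.2.
Proof.
move=> R; apply/neqbP/negP => /eqP Mu.
have := @reduced_convex (edge_wall x a) x [:: a] u R.
rewrite word_val_cons word_val_nil mulg1 hs_edge_wall hs_edge_wallN => /(_ Mu).
by case: a.2.
Qed.

Lemma intervalE x y z :
  interval S x y z <-> (wl (x^-1 * z) + wl (z^-1 * y) = wl (x^-1 * y))%N.
Proof. by rewrite /interval /= /prefix_le invgM invgK -mulgA mulVKg. Qed.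

Lemma interval_hsP x y z :
  interval S x y z <-> forall M, hs M x = hs M y -> hs M z = hs M x.
Proof.
split.
  move/intervalE=> d M Mxy.
  have [u ux us] := ex_shortest (x^-1 * z).
  have [v vz vs] := ex_shortest (z^-1 * y).
  have uv : word_val (u ++ v) = x^-1 * y.
    by rewrite word_val_cat ux vz -mulgA mulVKg.
  have R : reduced (u ++ v) by rewrite /reduced uv -d -us -vs size_cat.
  have := @reduced_convex M x u v R; rewrite uv ux !mulVKg; apply; exact/esym.
move=> I; apply/intervalE.
(* Walk from [x] towards [z]: the wall of the first edge separates [x] from [z], hence also from
   [y], so the step brings both one closer. *)
have [n] := ubnP (wl (x^-1 * z)); elim: n x I => // n IHn x I.
have [u ux us] := ex_shortest (x^-1 * z); rewrite -us.
case: u ux us => [|a u] ux us.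
  by rewrite word_val_nil in ux; rewrite -[z](mulVKg x) -ux mulg1.
have R : reduced (a :: u) by rewrite /reduced us ux.
rewrite us ltnS => lt_n.
have Mz : hs (edge_wall x a) z = ~~ a.2.
  by rewrite -(reduced_cons_hs x R) ux mulVKg.
have My : hs (edge_wall x a) y = ~~ a.2.
  apply/neqbP/negP => /eqP My.
  have := I (edge_wall x a); rewrite My Mz hs_edge_wall => /(_ erefl).
  by case: a.2.
rewrite -(exchange Mz) -(exchange My) addSn IHn //; last first.
  by rewrite -(exchange Mz) in lt_n.
move=> N; have [Nx|/neqbP Nx] := eqVneq (hs N (x * letter_val a)) (hs N x).
  by rewrite Nx => /I.
by rewrite !(crossing_wall Nx) Mz hs_edge_wallN.
Qed.

Lemma hs_inj x y : (forall M, hs M x = hs M y) -> x = y.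
Proof.
move=> E; have /intervalE : interval S x x y by apply/interval_hsP => M _; rewrite E.
rewrite mulVg word_length1 => /eqP.
rewrite addn_eq0 => /andP[/eqP/word_length_eq0 xy _].
by rewrite -[y](mulVKg x) xy mulg1.
Qed.

(** * Medians *)

(* Along a shortest path from [m] to a half-space containing [y] and [z], the *)
(* last two letters either can be exchanged, or cross nested walls: in both *)
(* cases a half-space closer to [m] contains [y] and [z]. *)
Lemma adjacent_wall M m y z :
  hs M y = ~~ hs M m -> hs M z = ~~ hs M m ->
  exists a, hs (edge_wall m a) y = ~~ a.2 /\ hs (edge_wall m a) z = ~~ a.2.
Proof.
have [u uE] := ex_path m y => My; rewrite -{1}uE in My.
have My' : hs M y = ~~ hs M m by rewrite -uE.
move: {uE} My My'; have [n] := ubnP (size u); elim: n M u => // n IHn M u.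
rewrite ltnS => un Mu My Mz.
have [R|] := boolP (reduced u); last first.
  rewrite /reduced -ltnNge => lt_u; have [v vu vs] := ex_shortest (word_val u).
  by apply: (IHn M v) => //; rewrite ?vu // vs (leq_trans lt_u).
case/lastP: u => [|u t] in un Mu R *.
  by move: Mu; rewrite word_val_nil mulg1; case: hs.
rewrite size_rcons in un.
have [Mc1|/neqbP Mc1] := eqVneq (hs M (m * word_val u)) (hs M m); last first.
  exact: (IHn M u).
rewrite word_val_rcons mulgA in Mu.
case/lastP: u => [|u s] in un Mu R Mc1 *.
  move: Mu; rewrite word_val_nil mulg1 => Mt.
  by exists t; rewrite -!(crossing_wall Mt) My Mz (crossing_wall Mt) hs_edge_wall.
rewrite size_rcons in un; rewrite word_val_rcons mulgA in Mc1 Mu.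
have [Mc0|/neqbP Mc0] := eqVneq (hs M (m * word_val u)) (hs M m); last first.
  by apply: (IHn M u) => //; apply: ltnW.
set c0 := m * word_val u in Mc0 Mc1 Mu.
have Mt : hs M (c0 * letter_val s * letter_val t) = ~~ hs M (c0 * letter_val s).
  by rewrite Mu Mc1.
have [L|nL] := boolP (link t.1 s.1).
  apply: (IHn M (rcons u t)) => //; first by rewrite size_rcons.
  rewrite word_val_rcons mulgA -/c0 -Mc0; apply/eqP; rewrite hs_neq.
  by rewrite -(crosses_link _ _ L) -mulgA -hs_neq; apply/eqP.
set K := edge_wall c0 s.
have Kc0 : hs K c0 = s.2 by rewrite hs_edge_wall.
have Kc1 : hs K (c0 * letter_val s) = ~~ s.2 by rewrite hs_edge_wallN.
have Km : hs K m = s.2.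
  apply/eqP/negPn/negP => /neqbP Km.
  have Rs : reduced (u ++ [:: s]).
    by rewrite cats1; move: R; rewrite -cats1; apply: reduced_catl.
  have := @reduced_convex K m u [:: s] Rs; rewrite cats1 word_val_rcons mulgA.
  by rewrite -/c0 Kc0 Kc1 Km => /(_ erefl); case: s.2.
have Kc2 : hs K (c0 * letter_val s * letter_val t) = ~~ s.2.
  rewrite -Kc1; apply/eqP/negPn/negP => /neqbP Kt.
  have E : hs K =1 hs M by move=> g; rewrite (crossing_wall Kt) (crossing_wall Mt).
  by move: Kc1; rewrite -Kc0 !E Mc0 Mc1; case: hs.
have far q : hs M q = ~~ hs M m -> hs K q = ~~ s.2.
  move=> Mq; apply/neqbP/negP => /eqP Kq.
  apply: (@no_crossing K M s.2 (hs M m) c0 q (c0 * letter_val s) _ _ Kc0) => //;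
    last exact: Mu; last by [].
  by rewrite /K /= -(crossing_label Mt) link_sym.
by apply: (IHn K (rcons u s));
  rewrite ?size_rcons ?word_val_rcons ?mulgA ?Km -/c0 //; apply: far.
Qed.

Definition maj (b c d : bool) : bool := [|| b && c, c && d | d && b].

(* The median minimises the sum of the distances to [x], [y] and [z]. *)
Lemma ex_median x y z :
  exists m, forall M, hs M m = maj (hs M x) (hs M y) (hs M z).
Proof.
pose D m := (wl (m^-1 * x) + wl (m^-1 * y) + wl (m^-1 * z))%N.
have ex : exists n, `[< exists m, D m = n >] by exists (D x); apply/asboolP; exists x.
case: (ex_minnP ex) => n /asboolP[m <-] min.
have {ex}Dmin q : (D m <= D q)%N by apply: min; apply/asboolP; exists q.
(* Were [m] separated from two of the points, a step across an adjacent wall would lower two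
   distances by one and raise the third by at most one. *)
have nsep x' y' z' M :
    (forall q, D q = wl (q^-1 * x') + wl (q^-1 * y') + wl (q^-1 * z'))%N ->
    hs M y' = ~~ hs M m -> hs M z' = ~~ hs M m -> False.
  move=> DE My Mz; have [a [ay az]] := adjacent_wall My Mz.
  have := Dmin (m * letter_val a); rewrite !DE -(exchange ay) -(exchange az).
  rewrite leqNgt addnS addnS => /negP; apply.
  rewrite ltnS -addSn !leq_add2r.
  rewrite invgM -mulgA (leq_trans (word_lengthM _ _)) // -letter_val_inv -add1n.
  by rewrite leq_add2r word_length_letter.
exists m => M; have := @nsep x y z M; have := @nsep y x z M; have := @nsep z x y M.
case: (hs M m); case: (hs M x); case: (hs M y); case: (hs M z) => //= h1 h2 h3.
all: try by case: h1 => // q; rewrite /D addnC addnA.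
all: try by case: h2 => // q; rewrite /D [X in (X + _)%N]addnC.
all: try by case: h3.
Qed.

Lemma prefix_hsP x y :
  prefix_le S x y <-> forall M, hs M 1 = hs M y -> hs M x = hs M 1.
Proof. by have := interval_hsP 1 y x; rewrite /interval /= invg1 !mul1g. Qed.

Lemma hs_meet M x y : hs M (meet S x y) = maj (hs M 1) (hs M x) (hs M y).
Proof.
have [m mE] := ex_median 1 x y; rewrite -mE; congr hs.
have mP : [/\ prefix_le S m x, prefix_le S m y &
    forall d, prefix_le S d x -> prefix_le S d y -> prefix_le S d m].
  split=> [||d /prefix_hsP tx /prefix_hsP ty]; apply/prefix_hsP => N.
  - by rewrite mE; case: (hs N 1); case: (hs N x); case: (hs N y).
  - by rewrite mE; case: (hs N 1); case: (hs N x); case: (hs N y).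
  - move: (tx N) (ty N); rewrite mE.
    by case: (hs N 1); case: (hs N x); case: (hs N y) => //= h1 h2 _;
      do ?[exact: h1 | exact: h2].
apply: xget_unique => // d [tx ty tm]; apply: hs_inj => N.
case: mP => mx my mt.
have [/(_ (mt _ tx ty) N) h1 _] := prefix_hsP d m.
have [/(_ (tm _ mx my) N) h2 _] := prefix_hsP m d.
by move: h1 h2; case: (hs N d); case: (hs N m); case: (hs N 1) => h1 h2;
  do ?[by have := h1 erefl | by have := h2 erefl].
Qed.

Lemma hsMl M g x : hs M (g * x) = hs (translate g^-1 M) x.
Proof. by rewrite hs_translate invgK. Qed.

Lemma hs_median M x y z : hs M (median S x y z) = maj (hs M x) (hs M y) (hs M z).
Proof. by rewrite /median hsMl hs_meet -!hsMl mulg1 !mulVKg. Qed.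

Lemma quasidir_opE w x y c :
  quasidir_set S w x y c ->
  (forall z, quasidir_set S w x y z -> interval S x z c) ->
  quasidir_op S w x y = c.
Proof.
move=> cU cmin; apply: xget_unique => // d [dU dmin].
apply: hs_inj => N; have /interval_hsP/(_ N) h1 := cmin _ dU.
have /interval_hsP/(_ N) h2 := dmin _ cU.
by move: h1 h2; case: (hs N c); case: (hs N d); case: (hs N x) => h1 h2;
  do ?[by have := h1 erefl | by have := h2 erefl].
Qed.

(** * Cyclic reduction *)

Lemma word_lengthV g : wl g^-1 = wl g.
Proof.
suff le h : (wl h^-1 <= wl h)%N by apply/eqP; rewrite eqn_leq le -{1}[g]invgK le.
have [u <- <-] := ex_shortest h.
by rewrite -word_val_inv (leq_trans (word_length_le _)) // size_rev size_map.
Qed.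

Lemma reduced_inv u : reduced (word_inv u) = reduced u.
Proof. by rewrite /reduced word_val_inv word_lengthV size_rev size_map. Qed.

(** The wall of each letter of a reduced word separates its ends, so every other word for the same
    element has a letter with that label. *)
Lemma reduced_link t u : reduced u -> linkgen t (word_val u) -> all (in_link t) u.
Proof.
move=> R [v vu Lv]; apply/allP => b /path.splitPr uE.
case: uE R vu => u1 u2 R vu; set N := edge_wall (word_val u1) b.
have N1 : hs N (word_val u1) = b.2 by rewrite hs_edge_wall.
have N2 : hs N (word_val u1 * letter_val b) = ~~ b.2 by rewrite hs_edge_wallN.
have Nu : hs N (1 * word_val (u1 ++ b :: u2)) = ~~ hs N 1.
  apply/neqbP/negP => /eqP Nu; have := reduced_convex R Nu.
  rewrite -cat_rcons in R Nu; have := reduced_convex R Nu.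
  by rewrite !mul1g word_val_rcons N1 N2 => <-; case: b.2.
rewrite -vu in Nu; have [v1 [a [v2 [vE e1 e2]]]] := first_crossing Nu.
have ab : a.1 = b.1 by apply: (@crossing_label N (1 * word_val v1)); rewrite e1.
by move: Lv; rewrite vE all_cat /= /in_link ab => /and3P[].
Qed.

(** If [u] did not cross the wall of [a] back again, [exchange] would make [a :: u] reduced;
    [backtrack] identifies the returning letter. *)
Lemma reduced_cons a u :
  reduced u -> ~~ reduced (a :: u) ->
  exists q r, u = q ++ letter_inv a :: r /\ all (in_link a.1) q.
Proof.
move=> R nR; set M := edge_wall 1 a.
have M1 : hs M 1 = a.2 by rewrite hs_edge_wall.
have Ma : hs M (1 * letter_val a) = ~~ hs M 1 by rewrite hs_edge_wallN M1.
have Mu : hs M (1 * letter_val a * word_val u) = ~~ hs M (1 * letter_val a).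
  rewrite Ma negbK M1; apply/eqP; apply: contraNT nR => /neqbP Mu.
  have := exchange Mu; rewrite invg1 !mul1g mulKg -word_val_cons.
  by rewrite /reduced => <-.
have [q [b [r [uE e1 e2]]]] := first_crossing Mu.
rewrite Ma negbK in e2; have [bE Lq] := backtrack Ma e1 e2.
exists q, r; rewrite uE bE; split=> //; apply: reduced_link => //.
by move: R; rewrite uE; apply: reduced_catl.
Qed.

Lemma link_nonreduced p a q r :
  all (in_link a.1) q -> ~~ reduced (p ++ a :: q ++ letter_inv a :: r).
Proof. by move=> Lq; apply: reduced_backtrack; exists q. Qed.

Lemma in_link_letter_inv a : in_link a.1 (letter_inv a) = false.
Proof. by rewrite /in_link link_irr. Qed.

Lemma nonreduced_cat u v :
  reduced v -> ~~ reduced (u ++ v) ->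
  exists u1 a u2,
    [/\ u = u1 ++ a :: u2, reduced (u2 ++ v) & ~~ reduced (a :: u2 ++ v)].
Proof.
move=> Rv; elim: u => [|a u IHu] /=; first by rewrite Rv.
have [R|/IHu[u1 [b [u2 [-> R nR]]] _]] := boolP (reduced (u ++ v)).
  by exists [::], a, u.
by exists (a :: u1), b, u2.
Qed.

Lemma eq_cat_cons (T : Type) (s1 s2 q r : seq T) (b : T) :
  s1 ++ s2 = q ++ b :: r ->
  (exists r', s1 = q ++ b :: r') \/ (exists q', q = s1 ++ q' /\ s2 = q' ++ b :: r).
Proof.
elim: s1 q => [|c s1 IHs] q /=; first by right; exists q.
case: q => [|d q] /= [-> E]; first by left; exists s1.
by case: (IHs _ E) => [[r' ->]|[q' [-> ->]]]; [left; exists r' | right; exists q'].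
Qed.

Definition word_pow u n : word S := flatten (nseq n u).

Lemma word_powS u n : word_pow u n.+1 = u ++ word_pow u n.
Proof. by []. Qed.

Lemma word_pow_add u m n : word_pow u (m + n) = word_pow u m ++ word_pow u n.
Proof. by rewrite /word_pow nseqD flatten_cat. Qed.

Lemma word_powSr u n : word_pow u n.+1 = word_pow u n ++ u.
Proof. by rewrite -addn1 word_pow_add /word_pow /= cats0. Qed.

Lemma word_val_pow u n : word_val (word_pow u n) = word_val u ^+ n.
Proof.
elim: n => [|n IHn]; first by rewrite word_val_nil expg0.
by rewrite word_powS word_val_cat IHn expgS.
Qed.

Lemma word_inv_pow u n : word_inv (word_pow u n) = word_pow (word_inv u) n.
Proof. by elim: n => // n IHn; rewrite word_powS word_inv_cat IHn -word_powSr. Qed.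

Lemma all_link_pow t u n : all (in_link t) u -> all (in_link t) (word_pow u n).
Proof. by move=> Lu; elim: n => //= n IHn; rewrite word_powS all_cat Lu. Qed.

(** A letter [a] of the first factor would have to cancel against a later [a^-1]. Within the next
    factor this contradicts [v v] being reduced; further on, [a] would have to pass a whole copy of
    [v], which contains [a], and [a] is not in its own link. *)
Lemma reduced_pow v n : reduced (v ++ v) -> reduced (word_pow v n).
Proof.
move=> Rvv; have Rv := reduced_catr Rvv.
case: n => [|n]; first by rewrite /reduced word_val_nil word_length1.
elim: n => [|n IHn]; first by rewrite word_powS cats0.
rewrite word_powS; apply/negPn/negP.
case/(nonreduced_cat IHn) => v1 [a [v2 [vE R nR]]].
have [q [r [qE Lq]]] := reduced_cons R nR.
rewrite word_powS catA in qE; case: (eq_cat_cons qE) => [[r' E]|[q' [E _]]].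
  move: Rvv; rewrite {1}vE -catA /= E.
  exact/negP/link_nonreduced.
have av : a \in v by rewrite vE mem_cat mem_head orbT.
move: Lq; rewrite E !all_cat => /andP[/andP[_ /allP/(_ _ av)]].
by rewrite /in_link link_irr.
Qed.

(** Either [b] cancels inside [k v], or it passes all of [k] and [v]; then every letter after it is
    in its link and none can be [b^-1]. *)
Lemma cons_conj_reduced b k v n :
  reduced (k ++ word_pow v n.+1 ++ word_inv k) ->
  reduced (b :: k ++ v ++ word_inv k) ->
  reduced (b :: k ++ word_pow v n.+1 ++ word_inv k).
Proof.
move=> R Rb; apply/negPn/negP => /(reduced_cons R)[q [r [qE Lq]]].
rewrite word_powS -catA catA in qE.
case: (eq_cat_cons qE) => [[r' E]|[q' [E Eq]]].
  move: Rb; rewrite catA -cat_cons => /reduced_catl; rewrite E.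
  exact/negP/(@link_nonreduced [::]).
move: Lq; rewrite E !all_cat => /andP[/andP[Lk Lv] _].
have : all (in_link b.1) (word_pow v n ++ word_inv k).
  by rewrite all_cat all_link_pow // all_link_inv.
by rewrite Eq all_cat /= in_link_letter_inv andbF.
Qed.

Lemma conj_reduced b k v n :
  reduced (k ++ word_pow v n.+1 ++ word_inv k) ->
  reduced (b :: (k ++ v ++ word_inv k) ++ [:: letter_inv b]) ->
  reduced (b :: (k ++ word_pow v n.+1 ++ word_inv k) ++ [:: letter_inv b]).
Proof.
set W := k ++ word_pow _ _ ++ _ => RW Rb.
have RbW : reduced (b :: W).
  by apply: cons_conj_reduced => //; move: Rb; rewrite -cat_cons; apply: reduced_catl.
have RWb : reduced (W ++ [:: letter_inv b]).
  rewrite -reduced_inv word_inv_cat /= /word_inv /= letter_invK -/(word_inv W).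
  have -> : word_inv W = k ++ word_pow (word_inv v) n.+1 ++ word_inv k.
    by rewrite /W (word_inv_cat k) word_inv_cat word_invK word_inv_pow catA.
  apply: cons_conj_reduced.
    rewrite -reduced_inv (word_inv_cat k) word_inv_cat word_inv_pow.
    by rewrite !word_invK -catA.
  rewrite -reduced_inv -cat1s !word_inv_cat !word_invK -!catA.
  by move: Rb; rewrite -cat1s => /reduced_catr; rewrite -!catA.
apply/negPn/negP => /(reduced_cons RWb)[q [r [qE Lq]]].
case: (eq_cat_cons qE) => [[r' E]|[q' [E _]]].
  by move: RbW; rewrite E; apply/negP/(@link_nonreduced [::]).
move: Lq; rewrite E /W !all_cat => /andP[/and3P[Lk /andP[Lv _] Lk'] _].
by move: Rb; apply/negP/(@link_nonreduced [::]); rewrite !all_cat Lk Lv.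
Qed.

(** Induction on length: if [v v] is reduced, [reduced_pow] applies with [k] empty; otherwise a
    letter is split off at both ends and added to [k]. *)
Lemma cyclic_reduction g :
  exists k v, word_val (k ++ v ++ word_inv k) = g /\
              forall n, reduced (k ++ word_pow v n.+1 ++ word_inv k).
Proof.
have [m] := ubnP (wl g); elim: m g => // m IHm g; rewrite ltnS => gm.
have [v vg Rv] := ex_reduced g.
have [Rvv|] := boolP (reduced (v ++ v)).
  by exists [::], v; rewrite cats0; split=> // n; rewrite cats0; apply: reduced_pow.
case/(nonreduced_cat Rv) => v1 [a [v2 [vE R nR]]].
have [q [r [qE Lq]]] := reduced_cons R nR.
case: (eq_cat_cons qE) => [[r' E]|[q' [E Eq]]].
  move: Rv; rewrite vE E => Rv; exfalso; move: Rv.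
  exact/negP/link_nonreduced.
move: Lq; rewrite E all_cat => /andP[Lv2 Lq'].
rewrite Eq in vE.
case: (eq_cat_cons (esym vE)) => [[r' E1]|[q'' [E1 E2]]]; last first.
  case: q'' E1 E2 => [|b q''] E1 [bE _].
    by move: bE; case: (a) => ? [] [].
  by move: Lq'; rewrite E1 all_cat /= -bE {2}/in_link link_irr andbF.
(* [v] starts with [a^-1] and ends with [a], up to commutations. *)
pose h := word_val (q' ++ r' ++ v2).
have vE' : v = q' ++ letter_inv a :: r' ++ a :: v2 by rewrite Eq vE E1 -catA.
have gE : g = (letter_val a)^-1 * h * letter_val a.
  have c1 := @linkgen_commute (letter_inv a) _ (linkgen_word Lq').
  have c2 := linkgen_commute (linkgen_word Lv2).
  rewrite letter_val_inv in c1.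
  rewrite -vg vE' /h !word_val_cat !word_val_cons word_val_cat word_val_cons.
  rewrite letter_val_inv.
  rewrite -!mulgA -c2 !mulgA; do 3!congr (_ * _).
  exact/esym.
have hm : ((wl h).+2 <= wl g)%N.
  rewrite -vg -(reduced_size Rv) vE' !size_cat /= size_cat /= !addnS !ltnS.
  by rewrite (leq_trans (word_length_le _)) // !size_cat.
have [k [u [ku Ru]]] := IHm h (leq_trans (ltnW hm) gm).
set b := letter_inv a; have bE : letter_inv b = a := letter_invK a.
have W n : (b :: k) ++ word_pow u n ++ word_inv (b :: k) =
    b :: (k ++ word_pow u n ++ word_inv k) ++ [:: letter_inv b].
  by rewrite word_inv_cons -cats1 -!catA.
have ku' : word_val (b :: (k ++ u ++ word_inv k) ++ [:: letter_inv b]) = g.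
  by rewrite word_val_cons cats1 word_val_rcons ku bE letter_val_inv gE mulgA.
exists (b :: k), u; split=> [|n].
  by rewrite -ku' word_inv_cons -cats1 -!catA.
rewrite W; apply: conj_reduced => //.
(* The word has length [l(h) + 2], since [k u k^-1] is reduced by the case of exponent one, and [hm]
   says that [g] is at least that long. *)
rewrite /reduced ku' /= size_cat addn1.
have := Ru 0%N; rewrite word_powS cats0 => /reduced_size->.
by rewrite ku.
Qed.

(** With [x^-1 w x = k v k^-1], the point [x k] lies on geodesics between any two of [w x], [x] and
    [w^-1 x], so it is their median, and [w] moves it by [v]. The geodesic from [w^-1 x] to [w x]
    reads [k v v k^-1]. *)
Lemma axis_ray w x :
  exists v, (forall n, reduced (word_pow v n)) /\
    forall n, w ^+ n * axis_proj S w x =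
              axis_proj S w x * word_val (word_pow v n).
Proof.
have [k [v [kv Rkv]]] := cyclic_reduction (x^-1 * w * x).
exists v; split=> [n|n].
  have := Rkv n; rewrite word_powS -catA => /reduced_catr.
  by rewrite catA -word_powS word_powSr -catA => /reduced_catl.
have wE : w = x * word_val k * word_val v * (x * word_val k)^-1.
  have -> : w = x * (x^-1 * w * x) * x^-1 by rewrite !mulgA mulgV mul1g mulgK.
  by rewrite -kv !word_val_cat word_val_inv invgM !mulgA.
suff -> : axis_proj S w x = x * word_val k.
  move: (x * word_val k) wE => z wE.
  rewrite word_val_pow; elim: n => [|n IHn]; first by rewrite !expg0 mul1g mulg1.
  by rewrite expgS -mulgA IHn expgS wE !mulgA mulgVK.
have kvk : x * word_val (k ++ v ++ word_inv k) = w * x.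
  by rewrite kv !mulgA mulgV mul1g.
have kvk' : x * word_val (k ++ word_inv v ++ word_inv k) = w^-1 * x.
  have -> : k ++ word_inv v ++ word_inv k = word_inv (k ++ v ++ word_inv k).
    by rewrite (word_inv_cat k) word_inv_cat word_invK catA.
  by rewrite word_val_inv kv !invgM invgK !mulgA mulgV mul1g.
have R1 : reduced (k ++ v ++ word_inv k).
  by have := Rkv 0%N; rewrite word_powS cats0.
have R1' : reduced (k ++ word_inv v ++ word_inv k).
  by rewrite -reduced_inv (word_inv_cat k) word_inv_cat !word_invK -catA.
have R2 : reduced ((k ++ v) ++ v ++ word_inv k).
  by have := Rkv 1%N; rewrite !word_powS cats0 -!catA.
apply: hs_inj => M; rewrite /axis_proj hs_median.
have h1 := @reduced_convex M x _ _ R1; rewrite kvk in h1.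
have h2 := @reduced_convex M x _ _ R1'; rewrite kvk' in h2.
have h3 := @reduced_convex M (w^-1 * x) _ _ R2.
have e1 : w^-1 * x * word_val (k ++ v) = x * word_val k.
  by rewrite wE word_val_cat !invgM !invgK !mulgA !mulgVK.
have e2 : w^-1 * x * word_val ((k ++ v) ++ v ++ word_inv k) = w * x.
  rewrite word_val_cat mulgA e1 -kvk !word_val_cat !mulgA //.
rewrite e1 e2 in h3; move: h1 h2 h3.
case: (hs M x); case: (hs M (w * x)); case: (hs M (w^-1 * x)) => //= h1 h2 h3.
all: first [by rewrite h1 | by rewrite h2 | by rewrite h3].
Qed.

(** * Limits along the ray *)

(** Once the ray has left the side of [z], [reduced_convex] forbids a return. *)
Lemma ray_stable M z v :
  (forall n, reduced (word_pow v n)) ->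
  exists m, forall n, (m <= n)%N ->
    hs M (z * word_val (word_pow v n)) = hs M (z * word_val (word_pow v m)).
Proof.
move=> R.
have [[m /neqbP Mm]|st] :=
  pselect (exists n, hs M (z * word_val (word_pow v n)) != hs M z).
  exists m => n /subnKC E; rewrite Mm; apply/neqbP/negP => /eqP Mn.
  move: (R n) Mn; rewrite -E word_pow_add => Rn /(reduced_convex Rn).
  by rewrite Mm; case: hs.
have st' n : hs M (z * word_val (word_pow v n)) = hs M z.
  by apply/eqP/negPn/negP => h; apply: st; exists n.
by exists 0 => n _; rewrite !st'.
Qed.

Lemma separating_walls x y :
  exists L : seq (S * G),
    forall M, hs M y = ~~ hs M x -> exists2 N, N \in L & hs M =1 hs N.
Proof.
have [u <-] := ex_path x y; elim: u x => [|a u IHu] x.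
  by exists [::] => M; rewrite word_val_nil mulg1; case: hs.
have [L IHx] := IHu (x * letter_val a).
exists (edge_wall x a :: L) => M; rewrite word_val_cons mulgA => Mu.
have [Ma|/neqbP Ma] := eqVneq (hs M (x * letter_val a)) (hs M x).
  by rewrite -Ma in Mu; have [N NL E] := IHx _ Mu; exists N; rewrite // inE NL orbT.
by exists (edge_wall x a); [rewrite inE eqxx | exact: crossing_wall Ma].
Qed.

Lemma ray_stable_seq (L : seq (S * G)) z v :
  (forall n, reduced (word_pow v n)) ->
  exists m, forall N n, N \in L -> (m <= n)%N ->
    hs N (z * word_val (word_pow v n)) = hs N (z * word_val (word_pow v m)).
Proof.
move=> R; elim: L => [|N L [m Lm]]; first by exists 0%N.
have [m' Nm'] := @ray_stable N z v R.
exists (maxn m m') => K n; rewrite inE geq_max => /predU1P[->|KL] /andP[mn m'n].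
  by rewrite Nm' // [RHS]Nm' // leq_maxr.
by rewrite Lm // [RHS]Lm // leq_maxl.
Qed.

Lemma first_switch (f : nat -> bool) c m :
  f 0%N = c -> f m = ~~ c -> exists n, f n = c /\ f n.+1 = ~~ c.
Proof.
elim: m => [|m IHm] f0 fm; first by move: fm; rewrite f0; case: (c).
by have [fm'|/neqbP /(IHm f0)//] := eqVneq (f m) c; exists m.
Qed.

(* All translates [w^-n M], [m <= n], separate [x] from [y]; only finitely *)
(* many walls do, so two of these translates coincide. *)
Lemma wall_period M w x y m :
  (forall n, (m <= n)%N -> hs M (w ^+ n * y) = ~~ hs M (w ^+ n * x)) ->
  exists k, forall g, hs M (w ^+ k.+1 * g) = hs M g.
Proof.
move=> sep; have [L LP] := separating_walls x y.
have /choice[f fP] n :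
    exists N, N \in L /\ (hs (translate (w ^+ (m + n))^-1 M) =1 hs N).
  have [|N NL E] := LP (translate (w ^+ (m + n))^-1 M); last by exists N.
  by rewrite -!hsMl sep // leq_addr.
have : ~~ uniq (map f (iota 0 (size L).+1)).
  apply/negP => /uniq_leq_size Us.
  have : (size L < size L)%N; last by rewrite ltnn.
  rewrite -[X in (X <= _)%N](size_iota 0) -(size_map f).
  by apply: Us => N /mapP[n _ ->]; case: (fP n).
case/(uniqPn (f 0%N)) => i [j []]; rewrite size_map size_iota => ij jL.
have iL := ltn_trans ij jL.
rewrite !(nth_map 0%N) ?size_iota // !nth_iota // !add0n => fE.
exists (j - i).-1 => g; rewrite prednK ?subn_gt0 //.
have [_ Ei] := fP i; have [_ Ej] := fP j.
have := Ei ((w ^+ (m + i))^-1 * g); rewrite fE -Ej -!hsMl mulVKg => ->.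
have -> : (m + j = (j - i) + (m + i))%N by rewrite addnCA subnK // ltnW.
by rewrite expgnDr -mulgA mulVKg.
Qed.

(** The hypothesis says that from index [m] on the ray has settled with respect to all walls
    separating [x] from [y]; only these can witness a failure for [c]. *)
Lemma quasidir_op_ray w x y m :
  let c := median S x y (w ^+ m * axis_proj S w x) in
  (forall M n, hs M y = ~~ hs M x -> (m <= n)%N ->
    hs M (w ^+ n * axis_proj S w x) = hs M (w ^+ m * axis_proj S w x)) ->
  quasidir_op S w x y = c.
Proof.
move=> c st; set a := axis_proj S w x in c st *.
have hc M : hs M c = maj (hs M x) (hs M y) (hs M (w ^+ m * a)).
  by rewrite hs_median.
have hwc M :
    hs M (w * c) = maj (hs M (w * x)) (hs M (w * y)) (hs M (w ^+ m.+1 * a)).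
  by rewrite hsMl hc -!hsMl expgS mulgA.
have ha M n : hs M (w ^+ n * a) =
    maj (hs M (w ^+ n.+1 * x)) (hs M (w ^+ n * x)) (hs M (w ^+ n * (w^-1 * x))).
  by rewrite expgSr hsMl hs_median -!hsMl !mulgA.
have nocross M (d d' : bool) p q r o :=
  @no_crossing M (translate w^-1 M) d d' p q r o (negbT (link_irr M.1)).
apply: quasidir_opE; first split.
- apply/interval_hsP => M e; rewrite hc e.
  by case: (hs M y); case: (hs M (w ^+ m * a)).
- apply/interval_hsP => M e; apply/eqP/negPn/negP => /neqbP Mc.
  have [My Mm] : hs M y = ~~ hs M x /\ hs M (w ^+ m * a) = ~~ hs M x.
    by move: Mc; rewrite hc; case: (hs M x); case: (hs M y); case: (hs M _).
  have Mm1 : hs M (w ^+ m.+1 * a) = ~~ hs M x by rewrite st // Mm.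
  have [Mwx Mwy] : hs M (w * x) = hs M x /\ hs M (w * y) = hs M x.
    move: e; rewrite hwc Mm1.
    by case: (hs M x); case: (hs M (w * x)); case: (hs M (w * y)).
  have M0 : hs M (w ^+ 0 * a) = hs M x.
    by rewrite ha expg0 expg1 Mwx !mul1g; case: (hs M x); case: (hs M _).
  (* The ray starts on the side of [x] and ends on the other; the last point before the switch fills
     the missing quadrant of [M] and [w^-1 M]. *)
  have [n [Mn Mn1]] := @first_switch (fun n => hs M (w ^+ n * a)) _ m M0 Mm.
  apply: (nocross M (hs M x) (hs M x) x (w ^+ n * a) y (w ^+ m * a)) => //.
  + by rewrite -hsMl.
  + by rewrite -hsMl mulgA -expgS.
  + by rewrite -hsMl.
  + by rewrite -hsMl mulgA -expgS.
- apply/interval_hsP => M e; apply/eqP/negPn/negP => /neqbP Mc.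
  have [Mx Mm] : hs M x = ~~ hs M y /\ hs M (w ^+ m * a) = ~~ hs M y.
    by move: Mc; rewrite hc; case: (hs M x); case: (hs M y); case: (hs M _).
  have Myx : hs M y = ~~ hs M x by rewrite Mx negbK.
  have Mm1 : hs M (w ^+ m.+1 * a) = ~~ hs M y by rewrite st // Mm.
  have [Mwx Mwy] : hs M (w * x) = hs M y /\ hs M (w * y) = hs M y.
    move: e; rewrite hwc Mm1.
    by case: (hs M y); case: (hs M (w * x)); case: (hs M (w * y)).
  (* The half-space of [y] is mapped into itself by [w], so it contains all [w^k x] with [k > 0],
     and with them the median [w^(m+1) a]. *)
  have step g : hs M g = hs M y -> hs M (w * g) = hs M y.
    move=> Mg; apply/eqP/negPn/negP => /neqbP Mwg.
    apply: (nocross M (hs M y) (hs M y) y g x (w ^+ m * a)) => //.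
    + by rewrite -hsMl.
    + by rewrite -hsMl.
    + by rewrite -hsMl.
    + by rewrite -hsMl mulgA -expgS.
  have Mk k : hs M (w ^+ k.+1 * x) = hs M y.
    by elim: k => [|k IHk]; rewrite ?expg1 // expgS -mulgA step.
  by move: Mm1; rewrite ha !Mk; case: (hs M y); case: (hs M _).
move=> z [zxy _ /interval_hsP zy]; apply/interval_hsP => M e.
apply/eqP/negPn/negP => /neqbP Mc.
have [My Mm] : hs M y = ~~ hs M x /\ hs M (w ^+ m * a) = ~~ hs M x.
  by move: Mc; rewrite hc; case: (hs M x); case: (hs M y); case: (hs M _).
have step1 N : hs N z = ~~ hs N y -> hs N (w * z) = hs N z.
  move=> Nz; have := zy N; rewrite Nz.
  by case: (hs N y); case: (hs N (w * z)) => // /(_ erefl).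
(* In the first case all [w^k x] lie on the side of [x], hence so does *)
(* [w^m a].  In the second, [w^k z] stays on the side of [x] while [w^k a] is *)
(* eventually on the other one, so [M] is [w]-periodic. *)
have [inc|/existsNP[g /not_implyP[Mg /eqP/neqbP Mwg]]] :=
  pselect (forall g, hs M g = hs M x -> hs M (w * g) = hs M x).
  have Mk k : hs M (w ^+ k * x) = hs M x.
    by elim: k => [|k IHk]; rewrite ?expg0 ?mul1g // expgS -mulgA inc.
  by move: Mm; rewrite ha !Mk; case: (hs M x); case: (hs M _).
have dec h : hs M h = ~~ hs M x -> hs M (w * h) = ~~ hs M x.
  move=> Mh; apply/neqbP/negP => /eqP Mwh.
  apply: (nocross M (hs M x) (hs M x) z g h (w ^+ m * a)) => //.
  + by rewrite -hsMl step1 -e // My negbK.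
  + by rewrite -hsMl.
  + by rewrite -hsMl.
  + by rewrite -hsMl mulgA -expgS st.
have decn n h : hs M h = ~~ hs M x -> hs M (w ^+ n * h) = ~~ hs M x.
  by elim: n => [|n IHn] Mh; rewrite ?expg0 ?mul1g // expgS -mulgA dec // IHn.
have Mz n : hs M (w ^+ n * z) = hs M x.
  elim: n => [|n IHn]; first by rewrite expg0 mul1g.
  (* Here [step1] is used for the translate [w^-n M], which separates [z] from [y] by the induction
     hypothesis and [decn]. *)
  rewrite expgSr -mulgA hsMl step1 -!hsMl IHn // decn ?negbK //.
have [n Mn|k Mk] := @wall_period M w z a m.
  by rewrite Mz st // Mm.
have Mw g' : hs M (w * g') = hs M g'.
  have [Mg'|/neqbP Mg'] := eqVneq (hs M g') (hs M x); last by rewrite Mg' dec.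
  rewrite Mg'; apply/eqP/negPn/negP => /neqbP /(decn k).
  by rewrite mulgA -expgSr Mk Mg'; case: (hs M x).
have Mwn n g' : hs M (w ^+ n * g') = hs M g'.
  by elim: n => [|n IHn]; rewrite ?expg0 ?mul1g // expgS -mulgA Mw.
by move: Mm; rewrite ha !Mwn; case: (hs M x); case: (hs M _).
Qed.

End RightAngledArtin.

Theorem corollary7p6 (G : groupType) (S : set G) (w : G) :
  is_raag S ->
  forall x y : G, exists m : nat, forall n : nat, (m <= n)%N ->
    quasidir_op S w x y = median S x y (w ^+ n * axis_proj S w x).
Proof.
move=> raagS x y; have [v [Rv ray]] := axis_ray raagS w x.
have [L LP] := separating_walls raagS x y.
have [m Lm] := ray_stable_seq raagS L (axis_proj S w x) Rv.
(* Each [n >= m] serves as the base index of [quasidir_op_ray], the ray being settled from [m]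
   on. *)
exists m => n mn; apply: (quasidir_op_ray raagS) => M k Mxy nk.
have [N NL E] := LP M Mxy.
by rewrite !E !ray !Lm // (leq_trans mn).
Qed.
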